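(* Let $G$ be a connected transmission-regular graph with $n$ vertices. Then for every vertex $v$ of $G$, $$n-1\leq T(v)\leq \left\lfloor\frac{n^2}{4}\right\rfloor .$$ Moreover, for $n>2$, equality $T(v)=n-1$ holds only when $G$ is the complete graph $K_n$, and equality $T(v)=\lfloor n^2/4\rfloor$ holds only when $G$ is the cycle graph $C_n$.
   Context: All graphs are finite, simple, undirected and loopless. For a connected graph $G$ and a vertex $v$, the transmission index of $v$ is $T(v)=\sum_{u\in V(G)} d(v,u)$, where $d(v,u)$ is the length of a shortest path between $v$ and $u$ (equivalently, $T(v)$ is the sum of the row of the distance matrix of $G$ corresponding to $v$). A connected graph is transmission-regular if all row sums of its distance matrix are equal, i.e. $T(v)$ is the same for all vertices $v$. *)

(* Defs.v *)
From mathcomp Require Import all_boot.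

Set Implicit Arguments.
Unset Strict Implicit.
Unset Printing Implicit Defensive.

Record sgraph := SGraph {
  svertex :> finType;
  adj : rel svertex;
  adj_sym : symmetric adj;
  adj_irrefl : irreflexive adj }.

Definition connected (G : sgraph) : Prop :=
  forall x y : G, connect (@adj G) x y.

Definition spath (G : sgraph) (x y : G) (p : seq G) : bool :=
  [&& path (@adj G) x p, last x p == y & uniq (x :: p)].

(* The least length of a path from [x] to [y]. A path has at most #|G| vertices,
   so its length is below #|G|; the value is #|G| when there is no path. *)
Definition dist (G : sgraph) (x y : G) : nat :=
  find (fun k => [exists p : k.-tuple G, spath x y p]) (iota 0 #|G|).

Lemma dist_min (G : sgraph) (x y : G) (p : seq G) :
  spath x y p -> dist x y <= size p.
Proof.
move=> sp; have ltp : size p < #|G|.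
  by case/and3P: sp => _ _ /card_uniqP /= <-; exact: max_card.
rewrite leqNgt; apply/negP => /(before_find 0).
rewrite nth_iota // add0n => /negbT /existsP[]; by exists (in_tuple p).
Qed.

Lemma dist_attained (G : sgraph) (x y : G) :
  connect (@adj G) x y -> exists2 p : seq G, spath x y p & size p = dist x y.
Proof.
case/connectP => q /shortenP[p pp up _] yE.
have sp : spath x y p by rewrite /spath pp up yE eqxx.
have ltp : size p < #|G| by move/card_uniqP: up => /= <-; exact: max_card.
have hasp : has (fun k => [exists p : k.-tuple G, spath x y p]) (iota 0 #|G|).
  apply/hasP; exists (size p); first by rewrite mem_iota.
  by apply/existsP; exists (in_tuple p).
have := nth_find 0 hasp; move: hasp; rewrite has_find size_iota => ltd.
by rewrite nth_iota // add0n => /existsP[t st]; exists t; rewrite ?size_tuple.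
Qed.

Definition transmission (G : sgraph) (v : G) : nat := \sum_(u : G) dist v u.

Definition transmission_regular (G : sgraph) : Prop :=
  forall v w : G, transmission v = transmission w.

Definition isomorphic (G H : sgraph) : Prop :=
  exists2 f : G -> H, bijective f & forall x y : G, adj (f x) (f y) = adj x y.

Definition complete_rel (n : nat) : rel 'I_n := fun i j => i != j.

Lemma complete_rel_sym n : symmetric (@complete_rel n).
Proof. by move=> i j; rewrite /complete_rel eq_sym. Qed.

Lemma complete_rel_irrefl n : irreflexive (@complete_rel n).
Proof. by move=> i; rewrite /complete_rel eqxx. Qed.

Definition complete_graph (n : nat) : sgraph :=
  SGraph (@complete_rel_sym n) (@complete_rel_irrefl n).

(* [ordS i] is i + 1 mod n. The condition [i != j] only matters for n = 1; the
   graph is the cycle C_n for n >= 3. *)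
Definition cycle_rel (n : nat) : rel 'I_n :=
  fun i j => (i != j) && ((j == ordS i) || (i == ordS j)).

Lemma cycle_rel_sym n : symmetric (@cycle_rel n).
Proof. by move=> i j; rewrite /cycle_rel eq_sym orbC. Qed.

Lemma cycle_rel_irrefl n : irreflexive (@cycle_rel n).
Proof. by move=> i; rewrite /cycle_rel eqxx. Qed.

Definition cycle_graph (n : nat) : sgraph :=
  SGraph (@cycle_rel_sym n) (@cycle_rel_irrefl n).

(* Main.v *)
Require Import Defs.
From mathcomp Require Import all_boot zify.

(** Write S_k for the number of vertices at distance more than k from v, so that
    T(v) is the sum of the S_k. Clearly S_0 = n - 1, which is the lower bound;
    equality forces every distance to be 1, for every vertex by regularity.

    For the upper bound, the point is that a transmission-regular graph has no
    cut vertex. If removing c separates A from B, the move from c to a neighbour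
    w in A brings us closer, by at most 1, to vertices of A only, and farther by
    exactly 1 from everything else, c included; so T(c) = T(w) forces
    |B| + 1 <= |A| ([card_compl_le_of_single_exit]), and symmetrically
    |A| + 1 <= |B|, a contradiction. Hence the sphere of radius k + 1 around v,
    which separates the vertices nearer to v from the farther ones, has at least
    two points as soon as some vertex lies beyond it ([sphere_ge2]). This says
    S_(k+1) <= S_k - 2 while S_(k+1) is positive, so S_k <= (n - 1) - 2k with
    truncated subtraction, and these bounds add up to the floor of n^2/4.

    If the sum is attained then S_k = (n - 1) - 2k for all k; the cases k = 0
    and k = 1 show that v has exactly two neighbours. By regularity this holds
    at every vertex, and a connected 2-regular graph is a cycle: the ends of a
    simple path that cannot be extended at its start are adjacent
    ([exists_cycle]), and no edge can leave the cycle that it then forms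
    ([adj_next]). *)

Set Implicit Arguments.
Unset Strict Implicit.
Unset Printing Implicit Defensive.

Section Connected.

Variable G : sgraph.
Hypothesis hconn : connected G.
Implicit Types (x y u v : G) (A : {set G}).

(** * Distances *)

Lemma dist_le_path x y (p : seq G) :
  path (@adj G) x p -> last x p = y -> dist x y <= size p.
Proof.
move=> pp; case/shortenP: pp => q qp qu sub qy.
apply: (@leq_trans (size q)).
  by apply: dist_min; rewrite /spath qp qu qy eqxx.
by apply: uniq_leq_size => //; case/andP: qu.
Qed.

Lemma dist_path x y :
  exists2 p : seq G, path (@adj G) x p /\ last x p = y & size p = dist x y.
Proof.
have [p /and3P[pp /eqP py _] ps] := dist_attained (hconn x y).
by exists p.
Qed.

Lemma dist_le_card x y : dist x y <= #|G|.
Proof. by rewrite /dist -[leqRHS](size_iota 0) find_size. Qed.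

Lemma distxx x : dist x x = 0.
Proof. by apply/eqP; rewrite -leqn0; apply: (@dist_le_path x x [::]). Qed.

Lemma dist_gt0 x y : (0 < dist x y) = (y != x).
Proof.
case: eqVneq => [->|ne]; first by rewrite distxx.
have [[|z p] [_ /= e] <-] := dist_path x y => //.
by rewrite -e eqxx in ne.
Qed.

Lemma dist_eq1 x y : (dist x y == 1) = adj x y.
Proof.
apply/eqP/idP => [d1|a].
  have [[|z [|? ?]] [/= pp e]] := dist_path x y; rewrite d1 //.
  by rewrite -e; case/andP: pp.
apply/eqP; rewrite eqn_leq dist_gt0; apply/andP; split.
  by apply: (@dist_le_path x y [:: y]) => //=; rewrite a.
by apply: contraTneq a => ->; rewrite adj_irrefl.
Qed.

Lemma dist_adjl x y u : adj x y -> dist x u <= (dist y u).+1.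
Proof.
move=> a; have [p [pp pu] <-] := dist_path y u.
by apply: (@dist_le_path x u (y :: p)) => //=; rewrite a.
Qed.

Lemma dist_adjr x y u : adj x y -> dist u y <= (dist u x).+1.
Proof.
move=> a; have [p [pp px] <-] := dist_path u x; rewrite -(size_rcons p y).
by apply: dist_le_path; rewrite ?last_rcons // rcons_path pp px.
Qed.

Lemma crossing_edge A x y :
  x \in A -> y \notin A -> exists a b, [/\ a \in A, b \notin A & adj a b].
Proof.
move=> xA; have /connectP[p pp ->] := hconn x y.
elim: p x xA pp => [|z p IH] x xA /=; first by rewrite xA.
case/andP=> a pp; case: (boolP (z \in A)) => zA; first exact: IH.
by move=> _; exists x, z.
Qed.

(** The first vertex outside A on a shortest path from x to u is c, and it comes
    after x. *)
Lemma dist_single_exit A c x u :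
    (forall a b, a \in A -> b \notin A -> adj a b -> b = c) ->
  x \in A -> u \notin A -> dist c u < dist x u.
Proof.
move=> exitA xA uA; have [p [pp pu] <-] := dist_path x u.
elim: p x xA pp pu => [|z p IH] x xA /=; first by move=> _ e; rewrite -e xA in uA.
case/andP=> a pp pu; case: (boolP (z \in A)) => zA.
  exact: ltnW (IH z zA pp pu).
by rewrite -(exitA _ _ xA zA a) ltnS; apply: dist_le_path.
Qed.

(** * Transmission-regular graphs have no cut vertex *)

(** If c is the only exit from A, moving from c to a neighbour w in A lowers
    the distance by at most 1, to vertices of A, and raises it everywhere else;
    regularity makes these changes cancel.
    The vertex c counts in the complement of A, since moving from c to its
    neighbour in A increases the distance to c too. This strictness is what
    lets the two sides of a cut vertex contradict each other. *)
Lemma card_compl_le_of_single_exit A c a :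
    transmission_regular G -> a \in A -> c \notin A ->
    (forall x y, x \in A -> y \notin A -> adj x y -> y = c) ->
  #|~: A| <= #|A|.
Proof.
move=> hreg aA cA exitA; have [w [z [wA zA wz]]] := crossing_edge aA cA.
have zc := exitA _ _ wA zA wz; subst z.
have: \sum_u (dist c u + (u \in ~: A)) <= \sum_u (dist w u + (u \in A)).
  apply: leq_sum => u _; rewrite inE.
  case: (boolP (u \in A)) => uA /=; rewrite ?addn0 addn1.
    by apply: dist_adjl; rewrite adj_sym.
  exact: dist_single_exit exitA wA uA.
rewrite !big_split /= -!/(transmission _) (hreg w c) leq_add2l.
by rewrite -!big_mkcond /= !sum1_card.
Qed.

(** A one-point sphere {c} would be the only exit both from the ball A inside
    it and from the set B outside it. The two resulting inequalities compare
    each of A and B, enlarged by c, with the other one, and cannot both hold. *)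
Lemma sphere_ge2 v u k :
  transmission_regular G -> k.+1 < dist v u ->
  1 < #|[set w | dist v w == k.+1]|.
Proof.
move=> hreg ltku; rewrite ltnNge; apply/negP => /card_le1_eqP single.
pose A := [set w | dist v w <= k]; pose B := [set w | k.+1 < dist v w].
have vA : v \in A by rewrite inE distxx.
have uB : u \in B by rewrite inE.
have uA : u \notin A by rewrite inE -ltnNge ltnW.
have [a [c [aA cA ac]]] := crossing_edge vA uA.
have dc : dist v c = k.+1.
  by move: aA cA (dist_adjr v ac); rewrite !inE; lia.
have on_sphere y : dist v y = k.+1 -> y = c.
  by move=> dy; apply: single; rewrite inE ?dy ?dc.
have exitA x y : x \in A -> y \notin A -> adj x y -> y = c.
  move=> xA yA xy; apply: on_sphere.
  by move: xA yA (dist_adjr v xy); rewrite !inE; lia.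
have exitB x y : x \in B -> y \notin B -> adj x y -> y = c.
  rewrite adj_sym => xB yB yx; apply: on_sphere.
  by move: xB yB (dist_adjr v yx); rewrite !inE; lia.
have cB : c \notin B by rewrite inE dc ltnn.
have leA := card_compl_le_of_single_exit hreg vA cA exitA.
have leB := card_compl_le_of_single_exit hreg uB cB exitB.
have ltBA : #|B| < #|~: A|.
  apply: proper_card; apply/properP; split; last by exists c; rewrite ?inE ?dc ?ltnn.
  by apply/subsetP => w; rewrite !inE -ltnNge; apply: ltnW.
have ltAB : #|A| < #|~: B|.
  apply: proper_card; apply/properP; split; last by exists c; rewrite ?inE ?dc ?ltnn.
  by apply/subsetP => w; rewrite !inE; lia.
by have := leq_trans ltBA leA; rewrite ltnNge (leq_trans (ltnW ltAB) leB).
Qed.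

(** * Counting the vertices beyond a given distance *)

Definition beyond v k := #|[set u | k < dist v u]|.

Lemma sum_ltn_ord n d : \sum_(k < n) (k < d) = minn d n.
Proof.
by elim: n => [|n IH]; rewrite ?big_ord0 ?minn0 // big_ord_recr /= IH; lia.
Qed.

Lemma transmission_beyond v : transmission v = \sum_(k < #|G|) beyond v k.
Proof.
transitivity (\sum_u \sum_(k < #|G|) (k < dist v u)).
  by apply: eq_bigr => u _; rewrite sum_ltn_ord (minn_idPl (dist_le_card v u)).
rewrite exchange_big /=; apply: eq_bigr => k _.
by rewrite -big_mkcond sum1dep_card.
Qed.

Lemma beyond0 v : beyond v 0 = #|G| - 1.
Proof.
rewrite /beyond subn1 -(cardsC1 v); apply: eq_card => u.
by rewrite !inE dist_gt0.
Qed.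

Lemma beyond_split v k :
  beyond v k = #|[set u | dist v u == k.+1]| + beyond v k.+1.
Proof.
rewrite /beyond -(cardsID [set u | dist v u == k.+1] [set u | k < dist v u]).
by congr (_ + _); apply: eq_card => u; rewrite !inE; lia.
Qed.

(** Truncated subtraction is the right bound: the step of the induction loses
    two vertices only while some vertex is still beyond the sphere. *)
Lemma beyond_le v k :
  transmission_regular G -> beyond v k <= #|G| - 1 - k.*2.
Proof.
move=> hreg; elim: k => [|k IH]; first by rewrite beyond0 subn0.
have [-> //|] := posnP (beyond v k.+1).
case/card_gt0P=> u; rewrite inE => lt; have := sphere_ge2 hreg lt.
by move: IH; rewrite (beyond_split v k); lia.
Qed.

Lemma sum_gaps n : \sum_(k < n) (n - 1 - k.*2) = n ^ 2 %/ 4.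
Proof.
elim/ltn_ind: n => -[|[|n]] IH; first by rewrite big_ord0.
  by rewrite big_ord_recl big_ord0.
(* Removing the first term, n + 1, and the last one, which is 0, leaves the
   sum for n; this matches (n + 2)^2 / 4 = n^2 / 4 + n + 1. *)
rewrite big_ord_recl big_ord_recr /=.
have gapE i : n.+2 - 1 - (bump 0 i).*2 = n - 1 - i.*2 by rewrite /bump; lia.
under eq_bigr => i _ do rewrite gapE.
rewrite IH // /bump -!mulnn; lia.
Qed.

Lemma transmission_bounds v :
  transmission_regular G -> #|G| - 1 <= transmission v <= #|G| ^ 2 %/ 4.
Proof.
move=> hreg; rewrite transmission_beyond; apply/andP; split; last first.
  by rewrite -sum_gaps; apply: leq_sum => k _; apply: beyond_le.
have lt0 : 0 < #|G| by apply/card_gt0P; exists v.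
by rewrite (bigD1 (Ordinal lt0)) //= beyond0 leq_addr.
Qed.

Lemma adj_of_transmission_min v u :
  transmission v = #|G| - 1 -> adj v u = (v != u).
Proof.
rewrite transmission_beyond => tv.
have [<-|ne] := eqVneq; first exact: adj_irrefl.
rewrite -dist_eq1 eqn_leq dist_gt0 eq_sym ne andbT leqNgt; apply/negP => lt.
have n1 : 1 < #|G|.
  by rewrite -cardsT (cardsD1 v) (cardsD1 u) !inE eq_sym ne.
move: tv; rewrite (bigD1 (Ordinal (ltnW n1))) //= (bigD1 (Ordinal n1)) //= beyond0.
rewrite -[RHS]addn0 => /addnI/eqP; rewrite addn_eq0 => /andP[/eqP b1 _].
have : 0 < beyond v 1 by apply/card_gt0P; exists u; rewrite inE.
by rewrite b1.
Qed.

(** Attaining the sum forces equality in each term; the degree is the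
    difference of the first two terms, n - 1 and n - 3. *)
Lemma degree_of_transmission_max v :
    transmission_regular G -> 2 < #|G| -> transmission v = #|G| ^ 2 %/ 4 ->
  #|[set u | adj v u]| = 2.
Proof.
move=> hreg n3; rewrite transmission_beyond -sum_gaps => tv.
have le (k : 'I_#|G|) : true ->
    beyond v k <= #|G| - 1 - k.*2 ?= iff (beyond v k == #|G| - 1 - k.*2).
  by move=> _; split; rewrite ?beyond_le.
have := (leqif_sum le).2; rewrite tv eqxx => /esym/forallP/= eqk.
have /eqP b1 := eqk (Ordinal (ltnW n3)).
have := beyond_split v 0; rewrite beyond0 b1 /=.
rewrite (_ : [set u | dist v u == 1] = [set u | adj v u]); last first.
  by apply/setP=> u; rewrite !inE dist_eq1.
move: n3 {b1 eqk le tv}; move: #|G| #|[set u | adj v u]| => m d.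
lia.
Qed.

(** * Connected 2-regular graphs are cycles *)

Section TwoRegular.

Hypothesis deg2 : forall x, #|[set u | adj x u]| = 2.

Lemma neighbour_dichotomy x a b u :
  adj x a -> adj x b -> a != b -> adj x u -> u = a \/ u = b.
Proof.
move=> xa xb ab xu; case: (eqVneq u a) => [|ua]; first by left.
case: (eqVneq u b) => [|ub]; first by right.
have: 2 < #|[set w | adj x w]|.
  apply/card_gt2P; exists u, a, b.
  by split; split; rewrite ?inE // eq_sym.
by rewrite deg2.
Qed.

Lemma exists_unextendable_path x p :
    path (@adj G) x p -> uniq (x :: p) ->
  exists y q, [/\ path (@adj G) y q, uniq (y :: q)
                & forall z, adj y z -> z \in y :: q].
Proof.
have [m] := ubnP (#|G| - size p); elim: m x p => // m IH x p ltm pp pu.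
have [/exists_inP[z xz zp]|] := boolP [exists (z | adj x z), z \notin x :: p].
  apply: (IH z (x :: p)); rewrite /= ?pp ?(adj_sym z) ?xz //; last by rewrite zp.
  have : size (z :: x :: p) <= #|G|.
    have zpu : uniq (z :: x :: p) by rewrite /= zp.
    by rewrite -(card_uniqP zpu) max_card.
  by move: ltm => /=; lia.
rewrite negb_exists_in => /forall_inP closed; exists x, p; split=> // z xz.
by have := closed z xz; rewrite negbK.
Qed.

(** All neighbours of the initial vertex y of a simple path that cannot be
    extended before y lie on the path, so besides the next vertex there is a
    second one z. If the path went on after z, then z would have three
    neighbours: y and its two neighbours on the path. Hence z is the endpoint,
    and the path closes up. *)
Lemma exists_cycle (v : G) :
  exists c : seq G, [/\ cycle (@adj G) c, uniq c & 2 < size c].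
Proof.
have [y [q [qp qu closed]]] := @exists_unextendable_path v [::] isT isT.
have /eqP/cards2P[a [b [ab nb]]] := deg2 y.
have [ya yb] : adj y a /\ adj y b.
  have : (a \in [set u | adj y u]) && (b \in [set u | adj y u]).
    by rewrite nb !inE !eqxx orbT.
  by rewrite !inE => /andP.
case: q qp qu closed => [|h q] /= qp qu closed.
  by have := closed a ya; rewrite inE => /eqP e; rewrite e adj_irrefl in ya.
case/andP: qp => yh qp; case/and3P: qu => yq hq qu.
have [z yz zq] : exists2 z, adj y z & z \in q.
  have [z [yz zh]] : exists z, adj y z /\ z != h.
    have [e|] := eqVneq a h; last by exists a.
    by exists b; rewrite yb -e eq_sym ab.
  exists z => //; have := closed z yz; rewrite !inE (negPf zh) /=.
  by case/orP=> // /eqP e; rewrite e adj_irrefl in yz.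
have q_end : exists q', q = rcons q' z.
  case/splitPr: zq qp qu yq hq {closed} => q1 q2.
  case: q2 => [|w q2]; first by exists q1; rewrite cats1.
  rewrite cat_path /= => /and4P[_ lz zw _] qu yq hq; exfalso.
  have lw : last h q1 != w.
    apply: contraTneq (mem_last h q1) => ->; rewrite inE negb_or.
    apply/andP; split.
      by apply: contraNneq hq => <-; rewrite mem_cat !inE eqxx !orbT.
    move: qu; rewrite cat_uniq => /and3P[_ /hasPn disj _].
    by apply: disj; rewrite !inE eqxx orbT.
  have zl : adj z (last h q1) by rewrite adj_sym.
  have zy : adj z y by rewrite adj_sym.
  have [e|e] := neighbour_dichotomy zl zw lw zy.
    have := mem_last h q1; rewrite -e inE => ym.
    by move: yq; rewrite inE mem_cat !negb_or; case/orP: ym => ->; rewrite ?andbF.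
  by move: yq; rewrite e inE mem_cat !inE eqxx !orbT.
case: q_end => q' e; subst q; exists [:: y, h & rcons q' z]; split.
- rewrite (cycle_path y) /= last_rcons yh qp !andbT.
  by rewrite adj_sym.
- by rewrite /= yq hq.
- by rewrite /= size_rcons.
Qed.

Section Cycle.

Variable c : seq G.
Hypotheses (cc : cycle (@adj G) c) (cu : uniq c) (c3 : 2 < size c).

Lemma next_next_neq x : x \in c -> next c (next c x) != x.
Proof.
move=> xc; case: (rot_to xc) => i s e.
rewrite -2!(next_rot i cu) e.
have: uniq (x :: s) by rewrite -e rot_uniq.
have: 2 < size (x :: s) by rewrite -e size_rot.
case: s {e} => [|a [|b s]] //= _; rewrite !inE !negb_or eqxx.
case/andP=> /and3P[xa xb _] _; rewrite [a == x]eq_sym (negPf xa) eqxx.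
by rewrite eq_sym.
Qed.

(** A vertex of the cycle has its predecessor and its successor on the cycle as
    neighbours; these differ because the cycle has length at least 3, so they
    are the only neighbours. *)
Lemma adj_next x y :
  x \in c -> adj x y -> y \in c /\ (y == next c x) || (x == next c y).
Proof.
move=> xc xy; have xn := next_cycle cc xc; have xp := prev_cycle cc xc.
rewrite adj_sym in xp.
have np : next c x != prev c x.
  apply: contraNneq (next_next_neq xc) => ->; exact/eqP/next_prev.
case: (neighbour_dichotomy xn xp np xy) => ->.
  by rewrite mem_next eqxx.
by rewrite mem_prev next_prev // eqxx orbT.
Qed.

Lemma mem_cycle_all x : x \in c.
Proof.
case: (boolP (x \in c)) => // xc; have [y yc] : exists y, y \in c.
  by case: c c3 => // y s _; exists y; rewrite mem_head.
have [a [b []]] : exists a b, [/\ a \in [set u in c], b \notin [set u in c] & adj a b].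
  by apply: (@crossing_edge _ y x); rewrite inE.
by rewrite !inE => ac bc ab; rewrite (adj_next ac ab).1 in bc.
Qed.

Lemma adj_cycle x y : adj x y = (y == next c x) || (x == next c y).
Proof.
apply/idP/orP => [xy|]; first exact/orP/(adj_next (mem_cycle_all x) xy).2.
case=> /eqP->; last rewrite adj_sym; exact: next_cycle cc (mem_cycle_all _).
Qed.

Lemma index_next x : index (next c x) c = (index x c).+1 %% size c.
Proof.
rewrite next_nth mem_cycle_all; have := mem_cycle_all x; have := cu.
case: c => // y p ypu xyp; rewrite -[size _]/(size p).+1.
have : index x (y :: p) <= size p by rewrite -ltnS (index_mem x (y :: p)).
rewrite leq_eqVlt => /orP[/eqP e|lt].
  by rewrite e nth_default // modnn index_head.
by rewrite modn_small // (index_uniq (i := (index x (y :: p)).+1) y _ ypu).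
Qed.

Lemma size_cycle_all : size c = #|G|.
Proof.
by rewrite -(card_uniqP cu); apply: eq_card => x; rewrite mem_cycle_all.
Qed.

Lemma index_lt_card x : index x c < #|G|.
Proof. by rewrite -size_cycle_all index_mem mem_cycle_all. Qed.

Lemma isomorphic_of_cycle : isomorphic G (cycle_graph #|G|).
Proof.
pose f x : cycle_graph #|G| := Ordinal (index_lt_card x).
have f_inj : injective f.
  move=> x y /(congr1 val) /= e; move: (mem_cycle_all x) (mem_cycle_all y).
  by move=> xc yc; rewrite -(nth_index x xc) e nth_index.
have f_next x : f (next c x) = ordS (f x).
  by apply: val_inj; rewrite /= index_next size_cycle_all.
exists f; first by apply: inj_card_bij => //; rewrite card_ord.
move=> x y; rewrite adj_cycle /= /cycle_rel -!f_next !(inj_eq f_inj).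
have [->/=|//] := eqVneq x y.
by rewrite orbb -[RHS]orbb -adj_cycle adj_irrefl.
Qed.

End Cycle.
End TwoRegular.
End Connected.

Lemma isomorphic_complete (G : sgraph) :
  (forall x y : G, adj x y = (x != y)) -> isomorphic G (complete_graph #|G|).
Proof.
move=> adjE; exists (@enum_rank G : G -> complete_graph #|G|).
  exact: enum_rank_bij.
by move=> x y; rewrite adjE /= /complete_rel (inj_eq enum_rank_inj).
Qed.

Theorem theorem3 (G : sgraph) (n : nat) (hn : #|G| = n)
  (hconn : connected G) (hreg : transmission_regular G) (v : G) :
  (n - 1 <= transmission v <= n ^ 2 %/ 4) /\
  (2 < n ->
     (transmission v = n - 1 -> isomorphic G (complete_graph n)) /\
     (transmission v = n ^ 2 %/ 4 -> isomorphic G (cycle_graph n))).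
Proof.
subst n; split; first exact: transmission_bounds.
move=> n3; split=> tv.
  apply: isomorphic_complete => x y.
  by apply: adj_of_transmission_min; rewrite // (hreg x v).
have deg2 (x : G) : #|[set u | adj x u]| = 2.
  by apply: degree_of_transmission_max; rewrite // (hreg x v).
have [c [cc cu c3]] := exists_cycle deg2 v.
exact: (isomorphic_of_cycle hconn deg2 cc cu c3).
Qed.
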